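(* None of the four Extended Haagerup fusion categories $\mathcal{EH}_1,\mathcal{EH}_2,\mathcal{EH}_3,\mathcal{EH}_4$ has the Isaacs property. That is, for each $n\in\{1,2,3,4\}$, the Grothendieck ring $R_n=K_0(\mathcal{EH}_n)$ is not an Isaacs fusion ring.
   Context: The Extended Haagerup fusion categories $\mathcal{EH}_1,\dots,\mathcal{EH}_4$ are four (pseudo-unitary) fusion categories over $\mathbb C$ constructed by Grossman, Morrison, Penneys, Peters and Snyder; all that is needed here are their Grothendieck rings, given below. (For a pseudo-unitary fusion category the categorical Isaacs property is equivalent to the Isaacs property of its Grothendieck ring.) Isaacs property. For a fusion ring $R$ with standard basis $\{x_0=1,\dots,x_m\}$ and involution $x_i^*=x_{i^*}$, let $d_i=\mathrm{FPdim}(x_i)$, $\mathrm{FPdim}(R)=\sum_i d_i^2$, $R_{\mathbb C}=R\otimes_{\mathbb Z}\mathbb C$ (semisimple), $\mathrm{Irr}(R_{\mathbb C})$ its irreducible representations identified with their trace characters, and $F^\rho$ the primitive central idempotent of $\rho$. Let $\{x_i^\circ\}$ be the basis of the linear dual $\widehat{R_{\mathbb C}}$ dual to $\{x_i\}$, let $\mathcal F:R_{\mathbb C}\to\widehat{R_{\mathbb C}}$ be the linear map $x_i\mapsto\mathrm{FPdim}(R)x_{i^*}^\circ$, put $\mathrm S^\rho=\mathcal F(F^\rho)$ and $\widetilde\omega_i(\mu)=\mu(x_i)/d_i$. $R$ is Isaacs if $\widetilde\omega_i(\mathrm S^\rho)$ is an algebraic integer for all $i$ and all $\rho\in\mathrm{Irr}(R_{\mathbb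 C})$. Grothendieck rings. The ring $R_n$ has standard basis $x_0=1,x_1,\dots,x_m$ with $x_ix_j=\sum_kN_{ij}^kx_k$ and $N_{ij}^k=(M_i)_{j,k}$ (row $j$, column $k$, indices from $0$). $M_0$ is the identity matrix; the other $M_i$ are listed by rows, each row being written as a string of one-digit entries. (Using the opposite convention replaces the ring by its opposite, which is isomorphic to it via $^*$.) $R_1$ ($m=5$, commutative): $M_1$: 010000, 111000, 011010, 000011, 001111, 000112. $M_2$: 001000, 011010, 111111, 001112, 011123, 001233. $M_3$: 000100, 000011, 001112, 101122, 011233, 012234. $M_4$: 000010, 001111, 011123, 011233, 112345, 013356. $M_5$: 000001, 000112, 001233, 012234, 013356, 123467. $R_2$ ($m=7$, noncommutative): $M_1$: 01000000, 11001000, 00000010, 00000100, 01001001, 00010111, 00100111, 00001111. $M_2$: 00100000, 00000100, 00000001, 10000100, 00000011, 00001111, 01100111, 00011111. $M_3$: 00010000, 00000010, 10000010, 00000001, 00000101, 01010111, 00001111, 00101111. $M_4$: 00001000, 01001001, 00000101, 00000011, 11001111, 00101222, 00011222, 01111222. $M_5$: 00000100, 00100111, 01100111, 00001111, 00011222, 11112433, 01112334, 01112344. $M_6$: 00000010, 00010111, 00001111, 01010111, 00101222, 01112334, 11112343, 01112434. $M_7$: 00000001, 00001111, 00011111, 00101111, 01111222, 01112344, 01112434, 11112444. $R_3$ ($m=7$, noncommutative): $M_1$: 01000000, 00000100, 10001000, 01000010, 00000001, 00100001, 00001011, 00010111. $M_2$: 00100000, 10010000, 00000100, 00000001, 00100010,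 01000001, 00010011, 00001111. $M_3$: 00010000, 00000001, 00100010, 10010011, 00000111, 00001111, 00111122, 01011123. $M_4$: 00001000, 01000010, 00000001, 00000111, 10001011, 00010111, 01011122, 00111123. $M_5$: 00000100, 00100001, 01000001, 00001111, 00010111, 10011111, 00011123, 01111133. $M_6$: 00000010, 00010011, 00001011, 01011122, 00111122, 00011123, 11122245, 01122356. $M_7$: 00000001, 00001111, 00010111, 00111123, 01011123, 01111133, 01122356, 11133367. $R_4$ ($m=7$, noncommutative): $M_1$: 01000000, 00010111, 10011011, 01101011, 01011111, 01111111, 00101112, 01111212. $M_2$: 00100000, 10011101, 00010111, 01101101, 00111111, 01001112, 01111111, 01111122. $M_3$: 00010000, 01101101, 01101011, 10011111, 01111111, 01011112, 00111112, 01111222. $M_4$: 00001000, 01011111, 00111111, 01111111, 11111112, 01111212, 01111122, 01112223. $M_5$: 00000100, 00101112, 01111111, 00111112, 01111212, 11112122, 01111222, 02122223. $M_6$: 00000010, 01111111, 01001112, 01011112, 01111122, 01111222, 11112212, 01222223. $M_7$: 00000001, 01111122, 01111212, 01111222, 01112223, 01222223, 02122223, 12223334. *)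

(* Defs.v *)
From HB Require Import structures.
From mathcomp Require Import all_boot all_order all_algebra.
From mathcomp Require Import complex reals.

Set Implicit Arguments.
Unset Strict Implicit.
Unset Printing Implicit Defensive.

Import Order.TTheory GRing.Theory Num.Theory.
Local Open Scope ring_scope.

(* A fusion ring is given by its structure constants on the standard basis
   x_0 = 1, ..., x_m with m = frank, namely x_i x_j = \sum_k (fusN i j k) x_k,
   and by the involution of the basis, x_i^* = x_(fdual i). *)
Record fusion_ring := FusionRing {
  frank : nat;
  fusN : 'I_frank.+1 -> 'I_frank.+1 -> 'I_frank.+1 -> nat;
  fdual : 'I_frank.+1 -> 'I_frank.+1;
  fus1x : forall j k, fusN ord0 j k = (j == k);
  fusx1 : forall j k, fusN j ord0 k = (j == k);
  fusA : forall i j k t,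
    (\sum_l fusN i j l * fusN l k t = \sum_l fusN j k l * fusN i l t)%N;
  fdualK : involutive fdual;
  fusN0 : forall i j, fusN i j ord0 = (j == fdual i);
  fus_dual : forall i j k, fusN i j k = fusN (fdual j) (fdual i) (fdual k)
}.

(* The K-algebra obtained from the fusion ring F by extension of scalars from
   the integers to K, in coordinates on the standard basis. *)
Definition fusion_alg (K : comNzRingType) (F : fusion_ring) : Type :=
  'rV[K]_((frank F).+1).

Section FusionAlgebra.
Variables (K : comNzRingType) (F : fusion_ring).
Notation I := 'I_(frank F).+1.
Notation A := (fusion_alg K F).

HB.instance Definition _ := Vector.on A.

Definition fcoord (i : I) (a : A) : K^o := (a : 'rV_((frank F).+1)) 0 i.
Definition fbasis (i : I) : A := delta_mx 0 i.
Definition fus_mul (a b : A) : A :=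
  \row_k \sum_i \sum_j fcoord i a * fcoord j b * (fusN i j k)%:R.

Lemma fcoord_is_linear i : linear (fcoord i).
Proof. by move=> c a b; rewrite /fcoord !mxE. Qed.
HB.instance Definition _ i :=
  GRing.isLinear.Build K A K^o *:%R (fcoord i) (fcoord_is_linear i).

Lemma fus_algP (a b : A) : (forall k, fcoord k a = fcoord k b) -> a = b.
Proof. by move=> eq_ab; apply/rowP=> k; apply: eq_ab. Qed.

Lemma fcoord_basis i k : fcoord k (fbasis i) = (k == i)%:R.
Proof. by rewrite /fcoord mxE eqxx. Qed.

Lemma fcoord_mul k a b :
  fcoord k (fus_mul a b)
  = \sum_i \sum_j fcoord i a * fcoord j b * (fusN i j k)%:R.
Proof. by rewrite {1}/fcoord mxE. Qed.

Lemma fcoordZ k c a : fcoord k (c *: a) = c * fcoord k a.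
Proof. by rewrite /fcoord mxE. Qed.

Lemma fus_mulA : associative fus_mul.
Proof.
move=> a b c; apply: fus_algP => t; rewrite !fcoord_mul.
transitivity (\sum_i \sum_j \sum_k fcoord i a * fcoord j b * fcoord k c
    * (\sum_l fusN j k l * fusN i l t)%:R).
  apply: eq_bigr => i _.
  under eq_bigr => l _.
    rewrite fcoord_mul mulr_sumr mulr_suml.
    under eq_bigr => j _ do rewrite mulr_sumr mulr_suml.
  over.
  rewrite exchange_big; apply: eq_bigr => j _.
  rewrite exchange_big; apply: eq_bigr => k _.
  rewrite natr_sum mulr_sumr; apply: eq_bigr => l _.
  by rewrite natrM !mulrA.
transitivity (\sum_i \sum_j \sum_k fcoord i a * fcoord j b * fcoord k c
    * (\sum_l fusN i j l * fusN l k t)%:R).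
  by do 3!apply: eq_bigr => ? _; rewrite fusA.
under [RHS]eq_bigr => l _.
  under eq_bigr => k _.
    rewrite fcoord_mul 2!mulr_suml.
    under eq_bigr => i _ do rewrite 2!mulr_suml.
  over.
  rewrite exchange_big.
over.
rewrite [RHS]exchange_big; apply: eq_bigr => i _.
under [RHS]eq_bigr => l _ do rewrite exchange_big.
rewrite [RHS]exchange_big; apply: eq_bigr => j _.
rewrite [RHS]exchange_big; apply: eq_bigr => k _.
rewrite natr_sum mulr_sumr; apply: eq_bigr => l _.
rewrite natrM !mulrA; congr (_ * _); rewrite -!mulrA; congr (_ * (_ * _)).
exact: mulrC.
Qed.

Lemma fus_mul1x : left_id (fbasis ord0) fus_mul.
Proof.
move=> a; apply: fus_algP => k; rewrite fcoord_mul (bigD1 ord0) //=.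
rewrite [X in _ + X]big1 ?addr0 => [|i /negPf i0]; last first.
  by apply: big1 => j _; rewrite fcoord_basis i0 !mul0r.
rewrite (bigD1 k) //= big1 ?addr0 => [|j /negPf jk].
  by rewrite fcoord_basis fus1x !eqxx mulr1 mul1r.
by rewrite fus1x jk mulr0.
Qed.

Lemma fus_mulx1 : right_id (fbasis ord0) fus_mul.
Proof.
move=> a; apply: fus_algP => k; rewrite fcoord_mul (bigD1 k) //=.
rewrite [X in _ + X]big1 ?addr0 => [|i /negPf ik]; last first.
  apply: big1 => j _; rewrite fcoord_basis; case: eqP => [->|_].
    by rewrite fusx1 ik mulr0.
  by rewrite mulr0 mul0r.
rewrite (bigD1 ord0) //= big1 ?addr0 => [|j /negPf j0].
  by rewrite fcoord_basis fusx1 !eqxx !mulr1.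
by rewrite fcoord_basis j0 mulr0 mul0r.
Qed.

Lemma fus_mulDl : left_distributive fus_mul +%R.
Proof.
move=> a b c; apply: fus_algP => k; rewrite linearD /= !fcoord_mul.
rewrite -big_split; apply: eq_bigr => i _; rewrite -big_split.
by apply: eq_bigr => j _; rewrite linearD /= !mulrDl.
Qed.

Lemma fus_mulDr : right_distributive fus_mul +%R.
Proof.
move=> a b c; apply: fus_algP => k; rewrite linearD /= !fcoord_mul.
rewrite -big_split; apply: eq_bigr => i _; rewrite -big_split.
by apply: eq_bigr => j _; rewrite linearD /= mulrDr mulrDl.
Qed.

Lemma fbasis0_neq0 : fbasis ord0 != 0.
Proof.
apply/eqP => /(congr1 (fcoord ord0)).
by rewrite fcoord_basis linear0 eqxx => /eqP; rewrite oner_eq0.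
Qed.

HB.instance Definition _ := GRing.Zmodule_isNzRing.Build A
  fus_mulA fus_mul1x fus_mulx1 fus_mulDl fus_mulDr fbasis0_neq0.

Lemma fus_scaleAl (c : K) (a b : A) : c *: (a * b) = c *: a * b.
Proof.
apply: fus_algP => k; rewrite fcoordZ !fcoord_mul mulr_sumr.
apply: eq_bigr => i _; rewrite mulr_sumr; apply: eq_bigr => j _.
by rewrite fcoordZ !mulrA.
Qed.

HB.instance Definition _ := GRing.Lmodule_isLalgebra.Build K A fus_scaleAl.

Lemma fus_scaleAr (c : K) (a b : A) : c *: (a * b) = a * (c *: b).
Proof.
apply: fus_algP => k; rewrite fcoordZ !fcoord_mul mulr_sumr.
apply: eq_bigr => i _; rewrite mulr_sumr; apply: eq_bigr => j _.
by rewrite fcoordZ !mulrA [c * _]mulrC.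
Qed.

HB.instance Definition _ := GRing.Lalgebra_isAlgebra.Build K A fus_scaleAr.

Definition fdual_basis (i : I) : 'Hom(A, K^o) := linfun (fcoord i).

End FusionAlgebra.

Section Isaacs.
Variables (C : numClosedFieldType) (F : fusion_ring).
Notation I := 'I_(frank F).+1.
Notation RC := (fusion_alg C F).

(* In row coordinates, v |-> v *m fus_mx i is left multiplication by x_i. *)
Definition fus_mx (i : I) : 'M[C]_((frank F).+1) :=
  \matrix_(j, k) (fusN i j k)%:R.

Definition spectrum n (M : 'M[C]_n) : seq C :=
  sval (closed_field_poly_normal (char_poly M)).

(* FPdim(x_i) is the largest nonnegative eigenvalue of left multiplication by
   x_i. In C, 0 <= a means that a is real and nonnegative. *)
Definition fpdim (i : I) : C :=
  \big[Num.max/0]_(a <- spectrum (fus_mx i) | 0 <= a) a.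

Definition FPdim : C := \sum_i fpdim i ^+ 2.

(* Matrices act on row vectors here; over a field, a matrix algebra is
   irreducible on row vectors if and only if it is on column vectors. *)
Definition irreducible_rep n (rho : {lrmorphism RC -> 'M[C]_n.+1}) : Prop :=
  forall U : 'M[C]_n.+1,
    (forall a : RC, stablemx U (rho a)) -> U != 0 -> row_full U.

Definition central_idempotent (e : RC) : Prop :=
  e * e = e /\ (forall a : RC, e * a = a * e).

Definition primitive_central_idempotent (e : RC) : Prop :=
  [/\ central_idempotent e, e != 0 &
      forall f : RC, central_idempotent f -> f * e = f -> f = 0 \/ f = e].

(* For rho irreducible, there is exactly one such e since RC is semisimple;
   it depends only on the isomorphism class of rho. *)
Definition is_pci_of n (rho : {lrmorphism RC -> 'M[C]_n.+1}) (e : RC) : Prop :=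
  primitive_central_idempotent e /\ rho e = 1.

Definition fourier (a : RC) : 'Hom(RC, C^o) :=
  \sum_i fcoord i a *: (FPdim *: fdual_basis C (fdual i)).

Definition omega (i : I) (mu : 'Hom(RC, C^o)) : C := mu (fbasis C i) / fpdim i.

Definition algebraic_integer (z : C) : Prop := integralOver (intr : int -> C) z.

Definition isaacs : Prop :=
  forall n (rho : {lrmorphism RC -> 'M[C]_n.+1}) (e : RC),
    irreducible_rep rho -> is_pci_of rho e ->
    forall i : I, algebraic_integer (omega i (fourier e)).

End Isaacs.

Section Tables.
Local Open Scope nat_scope.

Definition tabN (M : seq (seq (seq nat))) (i j k : nat) : nat :=
  nth 0 (nth [::] (nth [::] M i) j) k.

(* M is the list of fusion matrices and s the list of indices of the duals. *)
Definition fusion_check (m : nat) (M : seq (seq (seq nat))) (s : seq nat) :=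
  let r := iota 0 m.+1 in
  let N := tabN M in
  let d := nth 0 s in
  [&& all (fun j => all (fun k =>
        (N 0 j k == (j == k)) && (N j 0 k == (j == k))) r) r,
      all (fun i => all (fun j => all (fun k => all (fun t =>
        sumn [seq N i j l * N l k t | l <- r]
        == sumn [seq N j k l * N i l t | l <- r]) r) r) r) r,
      all (fun i => (d i < m.+1) && (d (d i) == i)) r,
      all (fun i => all (fun j => N i j 0 == (j == d i)) r) r &
      all (fun i => all (fun j => all (fun k =>
        N i j k == N (d j) (d i) (d k)) r) r) r].

Section FusionOfTable.
Variables (m : nat) (M : seq (seq (seq nat))) (s : seq nat).
Hypothesis Ms_ok : fusion_check m M s.

Let N (i j k : 'I_m.+1) := tabN M i j k.
Let d (i : 'I_m.+1) : 'I_m.+1 := inord (nth 0 s i).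

Let ordI (i : 'I_m.+1) : (i : nat) \in iota 0 m.+1.
Proof. by rewrite mem_iota /= add0n ltn_ord. Qed.

Let sumI (f : nat -> nat) :
  \sum_(l < m.+1) f l = sumn [seq f l | l <- iota 0 m.+1].
Proof. by rewrite sumnE big_map -(big_mkord xpredT f) /index_iota subn0. Qed.

Let dE i : d i = nth 0 s i :> nat.
Proof.
have /and5P[_ _ /allP/(_ _ (ordI i))/andP[di _] _ _] := Ms_ok.
exact: inordK.
Qed.

Lemma fusion_of_table_1x j k : N ord0 j k = (j == k).
Proof.
have /and5P[/allP/(_ _ (ordI j))/allP/(_ _ (ordI k))/andP[/eqP + _] _ _ _ _] :=
  Ms_ok.
exact.
Qed.

Lemma fusion_of_table_x1 j k : N j ord0 k = (j == k).
Proof.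
have /and5P[/allP/(_ _ (ordI j))/allP/(_ _ (ordI k))/andP[_ /eqP +] _ _ _ _] :=
  Ms_ok.
exact.
Qed.

Lemma fusion_of_table_A i j k t :
  \sum_l N i j l * N l k t = \sum_l N j k l * N i l t.
Proof.
have /and5P[_ /allP/(_ _ (ordI i))/allP/(_ _ (ordI j)) + _ _ _] := Ms_ok.
move=> /allP/(_ _ (ordI k))/allP/(_ _ (ordI t))/eqP eqA.
by rewrite (sumI (fun l => tabN M i j l * tabN M l k t)) eqA -sumI.
Qed.

Lemma fusion_of_table_dualK : involutive d.
Proof.
move=> i; apply: val_inj; rewrite /= !dE.
by have /and5P[_ _ /allP/(_ _ (ordI i))/andP[_ /eqP ddi] _ _] := Ms_ok.
Qed.

Lemma fusion_of_table_N0 i j : N i j ord0 = (j == d i).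
Proof.
have /and5P[_ _ _ /allP/(_ _ (ordI i))/allP/(_ _ (ordI j))/eqP + _] := Ms_ok.
by rewrite -dE.
Qed.

Lemma fusion_of_table_dual i j k : N i j k = N (d j) (d i) (d k).
Proof.
have /and5P[_ _ _ _ /allP/(_ _ (ordI i))/allP/(_ _ (ordI j)) +] := Ms_ok.
by move=> /allP/(_ _ (ordI k))/eqP; rewrite -!dE.
Qed.

Definition fusion_of_table : fusion_ring :=
  FusionRing fusion_of_table_1x fusion_of_table_x1 fusion_of_table_A
    fusion_of_table_dualK fusion_of_table_N0 fusion_of_table_dual.

End FusionOfTable.

(* EH1, ..., EH4 are the Grothendieck rings of the Extended Haagerup fusion
   categories constructed by Grossman, Morrison, Penneys, Peters and Snyder.
   The coefficient of x_k in x_i x_j is the entry (j, k) of the i-th matrix,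
   and x_i^* is the unique x_j such that x_i x_j has a term x_0. *)

Definition EH1_table : seq (seq (seq nat)) := [::
  [:: [:: 1; 0; 0; 0; 0; 0];
      [:: 0; 1; 0; 0; 0; 0];
      [:: 0; 0; 1; 0; 0; 0];
      [:: 0; 0; 0; 1; 0; 0];
      [:: 0; 0; 0; 0; 1; 0];
      [:: 0; 0; 0; 0; 0; 1]];
  [:: [:: 0; 1; 0; 0; 0; 0];
      [:: 1; 1; 1; 0; 0; 0];
      [:: 0; 1; 1; 0; 1; 0];
      [:: 0; 0; 0; 0; 1; 1];
      [:: 0; 0; 1; 1; 1; 1];
      [:: 0; 0; 0; 1; 1; 2]];
  [:: [:: 0; 0; 1; 0; 0; 0];
      [:: 0; 1; 1; 0; 1; 0];
      [:: 1; 1; 1; 1; 1; 1];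
      [:: 0; 0; 1; 1; 1; 2];
      [:: 0; 1; 1; 1; 2; 3];
      [:: 0; 0; 1; 2; 3; 3]];
  [:: [:: 0; 0; 0; 1; 0; 0];
      [:: 0; 0; 0; 0; 1; 1];
      [:: 0; 0; 1; 1; 1; 2];
      [:: 1; 0; 1; 1; 2; 2];
      [:: 0; 1; 1; 2; 3; 3];
      [:: 0; 1; 2; 2; 3; 4]];
  [:: [:: 0; 0; 0; 0; 1; 0];
      [:: 0; 0; 1; 1; 1; 1];
      [:: 0; 1; 1; 1; 2; 3];
      [:: 0; 1; 1; 2; 3; 3];
      [:: 1; 1; 2; 3; 4; 5];
      [:: 0; 1; 3; 3; 5; 6]];
  [:: [:: 0; 0; 0; 0; 0; 1];
      [:: 0; 0; 0; 1; 1; 2];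
      [:: 0; 0; 1; 2; 3; 3];
      [:: 0; 1; 2; 2; 3; 4];
      [:: 0; 1; 3; 3; 5; 6];
      [:: 1; 2; 3; 4; 6; 7]]].

Definition EH1_dual : seq nat := [:: 0; 1; 2; 3; 4; 5].

Lemma EH1_check : fusion_check 5 EH1_table EH1_dual.
Proof. by vm_compute. Qed.

Definition EH1 : fusion_ring := fusion_of_table EH1_check.

Definition EH2_table : seq (seq (seq nat)) := [::
  [:: [:: 1; 0; 0; 0; 0; 0; 0; 0];
      [:: 0; 1; 0; 0; 0; 0; 0; 0];
      [:: 0; 0; 1; 0; 0; 0; 0; 0];
      [:: 0; 0; 0; 1; 0; 0; 0; 0];
      [:: 0; 0; 0; 0; 1; 0; 0; 0];
      [:: 0; 0; 0; 0; 0; 1; 0; 0];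
      [:: 0; 0; 0; 0; 0; 0; 1; 0];
      [:: 0; 0; 0; 0; 0; 0; 0; 1]];
  [:: [:: 0; 1; 0; 0; 0; 0; 0; 0];
      [:: 1; 1; 0; 0; 1; 0; 0; 0];
      [:: 0; 0; 0; 0; 0; 0; 1; 0];
      [:: 0; 0; 0; 0; 0; 1; 0; 0];
      [:: 0; 1; 0; 0; 1; 0; 0; 1];
      [:: 0; 0; 0; 1; 0; 1; 1; 1];
      [:: 0; 0; 1; 0; 0; 1; 1; 1];
      [:: 0; 0; 0; 0; 1; 1; 1; 1]];
  [:: [:: 0; 0; 1; 0; 0; 0; 0; 0];
      [:: 0; 0; 0; 0; 0; 1; 0; 0];
      [:: 0; 0; 0; 0; 0; 0; 0; 1];
      [:: 1; 0; 0; 0; 0; 1; 0; 0];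
      [:: 0; 0; 0; 0; 0; 0; 1; 1];
      [:: 0; 0; 0; 0; 1; 1; 1; 1];
      [:: 0; 1; 1; 0; 0; 1; 1; 1];
      [:: 0; 0; 0; 1; 1; 1; 1; 1]];
  [:: [:: 0; 0; 0; 1; 0; 0; 0; 0];
      [:: 0; 0; 0; 0; 0; 0; 1; 0];
      [:: 1; 0; 0; 0; 0; 0; 1; 0];
      [:: 0; 0; 0; 0; 0; 0; 0; 1];
      [:: 0; 0; 0; 0; 0; 1; 0; 1];
      [:: 0; 1; 0; 1; 0; 1; 1; 1];
      [:: 0; 0; 0; 0; 1; 1; 1; 1];
      [:: 0; 0; 1; 0; 1; 1; 1; 1]];
  [:: [:: 0; 0; 0; 0; 1; 0; 0; 0];
      [:: 0; 1; 0; 0; 1; 0; 0; 1];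
      [:: 0; 0; 0; 0; 0; 1; 0; 1];
      [:: 0; 0; 0; 0; 0; 0; 1; 1];
      [:: 1; 1; 0; 0; 1; 1; 1; 1];
      [:: 0; 0; 1; 0; 1; 2; 2; 2];
      [:: 0; 0; 0; 1; 1; 2; 2; 2];
      [:: 0; 1; 1; 1; 1; 2; 2; 2]];
  [:: [:: 0; 0; 0; 0; 0; 1; 0; 0];
      [:: 0; 0; 1; 0; 0; 1; 1; 1];
      [:: 0; 1; 1; 0; 0; 1; 1; 1];
      [:: 0; 0; 0; 0; 1; 1; 1; 1];
      [:: 0; 0; 0; 1; 1; 2; 2; 2];
      [:: 1; 1; 1; 1; 2; 4; 3; 3];
      [:: 0; 1; 1; 1; 2; 3; 3; 4];
      [:: 0; 1; 1; 1; 2; 3; 4; 4]];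
  [:: [:: 0; 0; 0; 0; 0; 0; 1; 0];
      [:: 0; 0; 0; 1; 0; 1; 1; 1];
      [:: 0; 0; 0; 0; 1; 1; 1; 1];
      [:: 0; 1; 0; 1; 0; 1; 1; 1];
      [:: 0; 0; 1; 0; 1; 2; 2; 2];
      [:: 0; 1; 1; 1; 2; 3; 3; 4];
      [:: 1; 1; 1; 1; 2; 3; 4; 3];
      [:: 0; 1; 1; 1; 2; 4; 3; 4]];
  [:: [:: 0; 0; 0; 0; 0; 0; 0; 1];
      [:: 0; 0; 0; 0; 1; 1; 1; 1];
      [:: 0; 0; 0; 1; 1; 1; 1; 1];
      [:: 0; 0; 1; 0; 1; 1; 1; 1];
      [:: 0; 1; 1; 1; 1; 2; 2; 2];
      [:: 0; 1; 1; 1; 2; 3; 4; 4];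
      [:: 0; 1; 1; 1; 2; 4; 3; 4];
      [:: 1; 1; 1; 1; 2; 4; 4; 4]]].

Definition EH2_dual : seq nat := [:: 0; 1; 3; 2; 4; 5; 6; 7].

Lemma EH2_check : fusion_check 7 EH2_table EH2_dual.
Proof. by vm_compute. Qed.

Definition EH2 : fusion_ring := fusion_of_table EH2_check.

Definition EH3_table : seq (seq (seq nat)) := [::
  [:: [:: 1; 0; 0; 0; 0; 0; 0; 0];
      [:: 0; 1; 0; 0; 0; 0; 0; 0];
      [:: 0; 0; 1; 0; 0; 0; 0; 0];
      [:: 0; 0; 0; 1; 0; 0; 0; 0];
      [:: 0; 0; 0; 0; 1; 0; 0; 0];
      [:: 0; 0; 0; 0; 0; 1; 0; 0];
      [:: 0; 0; 0; 0; 0; 0; 1; 0];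
      [:: 0; 0; 0; 0; 0; 0; 0; 1]];
  [:: [:: 0; 1; 0; 0; 0; 0; 0; 0];
      [:: 0; 0; 0; 0; 0; 1; 0; 0];
      [:: 1; 0; 0; 0; 1; 0; 0; 0];
      [:: 0; 1; 0; 0; 0; 0; 1; 0];
      [:: 0; 0; 0; 0; 0; 0; 0; 1];
      [:: 0; 0; 1; 0; 0; 0; 0; 1];
      [:: 0; 0; 0; 0; 1; 0; 1; 1];
      [:: 0; 0; 0; 1; 0; 1; 1; 1]];
  [:: [:: 0; 0; 1; 0; 0; 0; 0; 0];
      [:: 1; 0; 0; 1; 0; 0; 0; 0];
      [:: 0; 0; 0; 0; 0; 1; 0; 0];
      [:: 0; 0; 0; 0; 0; 0; 0; 1];
      [:: 0; 0; 1; 0; 0; 0; 1; 0];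
      [:: 0; 1; 0; 0; 0; 0; 0; 1];
      [:: 0; 0; 0; 1; 0; 0; 1; 1];
      [:: 0; 0; 0; 0; 1; 1; 1; 1]];
  [:: [:: 0; 0; 0; 1; 0; 0; 0; 0];
      [:: 0; 0; 0; 0; 0; 0; 0; 1];
      [:: 0; 0; 1; 0; 0; 0; 1; 0];
      [:: 1; 0; 0; 1; 0; 0; 1; 1];
      [:: 0; 0; 0; 0; 0; 1; 1; 1];
      [:: 0; 0; 0; 0; 1; 1; 1; 1];
      [:: 0; 0; 1; 1; 1; 1; 2; 2];
      [:: 0; 1; 0; 1; 1; 1; 2; 3]];
  [:: [:: 0; 0; 0; 0; 1; 0; 0; 0];
      [:: 0; 1; 0; 0; 0; 0; 1; 0];
      [:: 0; 0; 0; 0; 0; 0; 0; 1];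
      [:: 0; 0; 0; 0; 0; 1; 1; 1];
      [:: 1; 0; 0; 0; 1; 0; 1; 1];
      [:: 0; 0; 0; 1; 0; 1; 1; 1];
      [:: 0; 1; 0; 1; 1; 1; 2; 2];
      [:: 0; 0; 1; 1; 1; 1; 2; 3]];
  [:: [:: 0; 0; 0; 0; 0; 1; 0; 0];
      [:: 0; 0; 1; 0; 0; 0; 0; 1];
      [:: 0; 1; 0; 0; 0; 0; 0; 1];
      [:: 0; 0; 0; 0; 1; 1; 1; 1];
      [:: 0; 0; 0; 1; 0; 1; 1; 1];
      [:: 1; 0; 0; 1; 1; 1; 1; 1];
      [:: 0; 0; 0; 1; 1; 1; 2; 3];
      [:: 0; 1; 1; 1; 1; 1; 3; 3]];
  [:: [:: 0; 0; 0; 0; 0; 0; 1; 0];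
      [:: 0; 0; 0; 1; 0; 0; 1; 1];
      [:: 0; 0; 0; 0; 1; 0; 1; 1];
      [:: 0; 1; 0; 1; 1; 1; 2; 2];
      [:: 0; 0; 1; 1; 1; 1; 2; 2];
      [:: 0; 0; 0; 1; 1; 1; 2; 3];
      [:: 1; 1; 1; 2; 2; 2; 4; 5];
      [:: 0; 1; 1; 2; 2; 3; 5; 6]];
  [:: [:: 0; 0; 0; 0; 0; 0; 0; 1];
      [:: 0; 0; 0; 0; 1; 1; 1; 1];
      [:: 0; 0; 0; 1; 0; 1; 1; 1];
      [:: 0; 0; 1; 1; 1; 1; 2; 3];
      [:: 0; 1; 0; 1; 1; 1; 2; 3];
      [:: 0; 1; 1; 1; 1; 1; 3; 3];
      [:: 0; 1; 1; 2; 2; 3; 5; 6];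
      [:: 1; 1; 1; 3; 3; 3; 6; 7]]].

Definition EH3_dual : seq nat := [:: 0; 2; 1; 3; 4; 5; 6; 7].

Lemma EH3_check : fusion_check 7 EH3_table EH3_dual.
Proof. by vm_compute. Qed.

Definition EH3 : fusion_ring := fusion_of_table EH3_check.

Definition EH4_table : seq (seq (seq nat)) := [::
  [:: [:: 1; 0; 0; 0; 0; 0; 0; 0];
      [:: 0; 1; 0; 0; 0; 0; 0; 0];
      [:: 0; 0; 1; 0; 0; 0; 0; 0];
      [:: 0; 0; 0; 1; 0; 0; 0; 0];
      [:: 0; 0; 0; 0; 1; 0; 0; 0];
      [:: 0; 0; 0; 0; 0; 1; 0; 0];
      [:: 0; 0; 0; 0; 0; 0; 1; 0];
      [:: 0; 0; 0; 0; 0; 0; 0; 1]];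
  [:: [:: 0; 1; 0; 0; 0; 0; 0; 0];
      [:: 0; 0; 0; 1; 0; 1; 1; 1];
      [:: 1; 0; 0; 1; 1; 0; 1; 1];
      [:: 0; 1; 1; 0; 1; 0; 1; 1];
      [:: 0; 1; 0; 1; 1; 1; 1; 1];
      [:: 0; 1; 1; 1; 1; 1; 1; 1];
      [:: 0; 0; 1; 0; 1; 1; 1; 2];
      [:: 0; 1; 1; 1; 1; 2; 1; 2]];
  [:: [:: 0; 0; 1; 0; 0; 0; 0; 0];
      [:: 1; 0; 0; 1; 1; 1; 0; 1];
      [:: 0; 0; 0; 1; 0; 1; 1; 1];
      [:: 0; 1; 1; 0; 1; 1; 0; 1];
      [:: 0; 0; 1; 1; 1; 1; 1; 1];
      [:: 0; 1; 0; 0; 1; 1; 1; 2];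
      [:: 0; 1; 1; 1; 1; 1; 1; 1];
      [:: 0; 1; 1; 1; 1; 1; 2; 2]];
  [:: [:: 0; 0; 0; 1; 0; 0; 0; 0];
      [:: 0; 1; 1; 0; 1; 1; 0; 1];
      [:: 0; 1; 1; 0; 1; 0; 1; 1];
      [:: 1; 0; 0; 1; 1; 1; 1; 1];
      [:: 0; 1; 1; 1; 1; 1; 1; 1];
      [:: 0; 1; 0; 1; 1; 1; 1; 2];
      [:: 0; 0; 1; 1; 1; 1; 1; 2];
      [:: 0; 1; 1; 1; 1; 2; 2; 2]];
  [:: [:: 0; 0; 0; 0; 1; 0; 0; 0];
      [:: 0; 1; 0; 1; 1; 1; 1; 1];
      [:: 0; 0; 1; 1; 1; 1; 1; 1];
      [:: 0; 1; 1; 1; 1; 1; 1; 1];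
      [:: 1; 1; 1; 1; 1; 1; 1; 2];
      [:: 0; 1; 1; 1; 1; 2; 1; 2];
      [:: 0; 1; 1; 1; 1; 1; 2; 2];
      [:: 0; 1; 1; 1; 2; 2; 2; 3]];
  [:: [:: 0; 0; 0; 0; 0; 1; 0; 0];
      [:: 0; 0; 1; 0; 1; 1; 1; 2];
      [:: 0; 1; 1; 1; 1; 1; 1; 1];
      [:: 0; 0; 1; 1; 1; 1; 1; 2];
      [:: 0; 1; 1; 1; 1; 2; 1; 2];
      [:: 1; 1; 1; 1; 2; 1; 2; 2];
      [:: 0; 1; 1; 1; 1; 2; 2; 2];
      [:: 0; 2; 1; 2; 2; 2; 2; 3]];
  [:: [:: 0; 0; 0; 0; 0; 0; 1; 0];
      [:: 0; 1; 1; 1; 1; 1; 1; 1];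
      [:: 0; 1; 0; 0; 1; 1; 1; 2];
      [:: 0; 1; 0; 1; 1; 1; 1; 2];
      [:: 0; 1; 1; 1; 1; 1; 2; 2];
      [:: 0; 1; 1; 1; 1; 2; 2; 2];
      [:: 1; 1; 1; 1; 2; 2; 1; 2];
      [:: 0; 1; 2; 2; 2; 2; 2; 3]];
  [:: [:: 0; 0; 0; 0; 0; 0; 0; 1];
      [:: 0; 1; 1; 1; 1; 1; 2; 2];
      [:: 0; 1; 1; 1; 1; 2; 1; 2];
      [:: 0; 1; 1; 1; 1; 2; 2; 2];
      [:: 0; 1; 1; 1; 2; 2; 2; 3];
      [:: 0; 1; 2; 2; 2; 2; 2; 3];
      [:: 0; 2; 1; 2; 2; 2; 2; 3];
      [:: 1; 2; 2; 2; 3; 3; 3; 4]]].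

Definition EH4_dual : seq nat := [:: 0; 2; 1; 3; 4; 5; 6; 7].

Lemma EH4_check : fusion_check 7 EH4_table EH4_dual.
Proof. by vm_compute. Qed.

Definition EH4 : fusion_ring := fusion_of_table EH4_check.

End Tables.

(* Main.v *)
From HB Require Import structures.
Require Import Defs.
From mathcomp Require Import all_boot all_order all_algebra.
From mathcomp Require Import complex reals ring lra.

Set Implicit Arguments.
Unset Strict Implicit.
Unset Printing Implicit Defensive.

Import Order.TTheory GRing.Theory Num.Theory.
Local Open Scope ring_scope.

(** A one-dimensional representation l of R_C has central idempotent
    e = f^-1 \sum_i l(x_i^* ) x_i, with f = \sum_i l(x_i) l(x_i^* ), so the
    Isaacs property makes z = FPdim l(x_i) / (f d_i) an algebraic integer. For
    the four rings the dimensions d_i lie in the cyclic cubic field of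
    conductor 13, and we take l = sigma o d with sigma a nontrivial Galois
    automorphism. There f = sigma(FPdim) is FPdim times a unit, so
    z = u sigma(d_i) / d_i with u a unit; for an x_i whose dimension has norm
    -5, this is not integral, because 5 splits completely. Concretely z is a
    root of 5 z^3 + b z^2 + c z - 5 with b + c odd; this cubic is irreducible
    mod 2, hence over Q, so Gauss's lemma forbids z to be integral unless 5
    divides b. *)

(** * One-dimensional representations of a fusion ring *)

(** Frobenius reciprocity: both sides are the coefficient of x_0 in x_i x_j x_k, bracketed in the
    two ways. *)
Lemma fusN_rot (F : fusion_ring) (i j k : 'I_(frank F).+1) :
  fusN i j (fdual k) = fusN j k (fdual i).
Proof.
have := fusA i j k ord0.
under eq_bigr do rewrite fusN0.
under [X in _ = X -> _]eq_bigr do rewrite fusN0.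
rewrite (bigD1 (fdual k)) //= fdualK eqxx muln1 big1 => [|l lk]; last first.
  by rewrite [k == _]eq_sym (can2_eq (@fdualK F) (@fdualK F)) (negPf lk) muln0.
rewrite (bigD1 (fdual i)) //= eqxx muln1 big1 ?addn0 // => l /negPf->.
by rewrite muln0.
Qed.

Definition fusion_character (K : comNzRingType) (F : fusion_ring)
    (l : 'I_(frank F).+1 -> K) : Prop :=
  l ord0 = 1 /\ forall i j, l i * l j = \sum_k (fusN i j k)%:R * l k.

Section Character.
Variables (K : comNzRingType) (F : fusion_ring).
Notation I := 'I_(frank F).+1.
Variables (l : I -> K) (lP : fusion_character l).

Definition char_eval (a : fusion_alg K F) : K := \sum_i fcoord i a * l i.

Lemma char_evalD a b : char_eval (a + b) = char_eval a + char_eval b.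
Proof.
by rewrite -big_split; apply: eq_bigr => i _; rewrite linearD mulrDl.
Qed.

Lemma char_evalZ c a : char_eval (c *: a) = c * char_eval a.
Proof. by rewrite mulr_sumr; apply: eq_bigr => i _; rewrite fcoordZ mulrA. Qed.

Lemma char_eval_basis i : char_eval (fbasis K i) = l i.
Proof.
rewrite /char_eval (bigD1 i) //= big1 => [|j /negPf ji].
  by rewrite fcoord_basis eqxx mul1r addr0.
by rewrite fcoord_basis ji mul0r.
Qed.

Lemma char_evalM a b : char_eval (a * b) = char_eval a * char_eval b.
Proof.
rewrite /char_eval mulr_suml.
under eq_bigr => k _ do rewrite fcoord_mul mulr_suml.
rewrite exchange_big; apply: eq_bigr => i _; rewrite mulr_sumr.
under eq_bigr => k _ do rewrite mulr_suml.
rewrite exchange_big; apply: eq_bigr => j _.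
rewrite mulrACA lP.2 mulr_sumr; apply: eq_bigr => k _.
by rewrite mulrA.
Qed.

(** The proof that [l] is a character is an argument so that morphism instances can be attached to
    [char_rep lP]. *)
Definition char_rep of fusion_character l :=
  fun a : fusion_alg K F => (char_eval a)%:M : 'M[K]_1.

Lemma char_rep_is_linear : linear (char_rep lP).
Proof.
move=> c a b; rewrite /char_rep char_evalD char_evalZ raddfD /=.
by rewrite scale_scalar_mx.
Qed.

Lemma char_rep_is_monoid_morphism : monoid_morphism (char_rep lP).
Proof.
split; first by rewrite /char_rep char_eval_basis lP.1.
by move=> a b; rewrite /char_rep char_evalM scalar_mxM.
Qed.

HB.instance Definition _ :=
  GRing.isLinear.Build K (fusion_alg K F) 'M[K]_1 *:%R (char_rep lP)
    char_rep_is_linear.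
HB.instance Definition _ :=
  GRing.isMonoidMorphism.Build (fusion_alg K F) 'M[K]_1 (char_rep lP)
    char_rep_is_monoid_morphism.

Definition formal_codegree : K := \sum_i l i * l (fdual i).

(** Thus \sum_j l(fdual j) x_j is an eigenvector of left multiplication by x_i; rotating the
    structure constants gives the expansion of l(fdual k) l(i). The next lemma treats right
    multiplication. *)
Lemma character_mul_dualr i k :
  \sum_j l (fdual j) * (fusN i j k)%:R = l i * l (fdual k).
Proof.
rewrite (reindex_inj (inv_inj (@fdualK F))) mulrC lP.2; apply: eq_bigr => j _.
by rewrite fdualK mulrC -{1}[k]fdualK 2!fusN_rot fdualK.
Qed.

Lemma character_mul_duall j k :
  \sum_i l (fdual i) * (fusN i j k)%:R = l j * l (fdual k).
Proof.
rewrite (reindex_inj (inv_inj (@fdualK F))) lP.2; apply: eq_bigr => i _.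
by rewrite fdualK mulrC -{1}[k]fdualK fusN_rot fdualK.
Qed.

End Character.

(** * The central idempotent of a character *)

Section Idempotent.
Variables (K : numClosedFieldType) (F : fusion_ring).
Notation I := 'I_(frank F).+1.
Variables (l : I -> K) (lP : fusion_character l).
Hypothesis l_neq0 : formal_codegree l != 0.

Definition char_idem : fusion_alg K F :=
  \row_k (l (fdual k) / formal_codegree l).

Lemma fcoord_char_idem k :
  fcoord k char_idem = l (fdual k) / formal_codegree l.
Proof. by rewrite /fcoord mxE. Qed.

(** With its mirror image, this makes the ideal of e the line through e, whence centrality; l(e) = 1
    then gives idempotence. *)
Lemma mulr_char_idem a : a * char_idem = char_eval l a *: char_idem.
Proof.
apply: fus_algP => k; rewrite fcoordZ fcoord_char_idem fcoord_mul mulr_suml.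
apply: eq_bigr => i _; rewrite -mulrA [l i * _]mulrA.
rewrite -(character_mul_dualr lP) mulr_suml mulr_sumr; apply: eq_bigr => j _.
by rewrite fcoord_char_idem -mulrA [_ / _ * _]mulrAC.
Qed.

Lemma mull_char_idem a : char_idem * a = char_eval l a *: char_idem.
Proof.
apply: fus_algP => k; rewrite fcoordZ fcoord_char_idem fcoord_mul mulr_suml.
rewrite exchange_big; apply: eq_bigr => j _; rewrite -mulrA [l j * _]mulrA.
rewrite -(character_mul_duall lP) mulr_suml mulr_sumr; apply: eq_bigr => i _.
by rewrite fcoord_char_idem mulrAC [LHS]mulrC [_ / _ * _]mulrAC.
Qed.

Lemma char_eval_idem : char_eval l char_idem = 1.
Proof.
rewrite /char_eval; under eq_bigr => i _.
  by rewrite fcoord_char_idem mulrAC [_ * l i]mulrC; over.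
by rewrite -mulr_suml divff.
Qed.

Lemma char_idem_is_pci : is_pci_of (char_rep lP) char_idem.
Proof.
have eval0 : char_eval l 0 = 0 by rewrite -(scale0r 0) char_evalZ mul0r.
split; last by rewrite /= /char_rep char_eval_idem.
split=> [||f [ff _] fe].
- split=> [|a]; first by rewrite mulr_char_idem char_eval_idem scale1r.
  by rewrite mulr_char_idem mull_char_idem.
- apply/eqP => e0; have /eqP := char_eval_idem.
  by rewrite e0 eval0 eq_sym oner_eq0.
(* Here f = l(f) e, and l(f) is an idempotent of a field, hence 0 or 1. *)
- rewrite -{1 2}fe mulr_char_idem.
  have /eqP := char_evalM lP f f.
  rewrite ff -subr_eq0 -{1}[char_eval l f]mulr1 -mulrBr mulf_eq0 subr_eq0.
  case/orP=> /eqP; first by move=> ->; left; rewrite scale0r.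
  by move=> <-; right; rewrite scale1r.
Qed.

Lemma char_rep_irreducible : irreducible_rep (char_rep lP).
Proof.
by move=> U _ U0; rewrite /row_full eqn_leq rank_leq_col lt0n mxrank_eq0.
Qed.

Lemma omega_char_idem i :
  omega i (fourier char_idem)
  = FPdim K F * l i / (formal_codegree l * fpdim K i).
Proof.
(* [fourier] sends x_j to a multiple of the dual vector of index [fdual j], so at x_i only j =
   [fdual i] survives. *)
rewrite /omega /fourier sum_lfunE (bigD1 (fdual i)) //= big1 => [|j ji].
  rewrite !scale_lfunE lfunE /= fcoord_basis fdualK eqxx fcoord_char_idem.
  rewrite fdualK addr0 /GRing.scale /= mulr1 invfM.
  by rewrite [_ / _ * FPdim _ _]mulrC !mulrA.
rewrite !scale_lfunE lfunE /= fcoord_basis (can2_eq (@fdualK F) (@fdualK F)).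
by rewrite (negPf ji) /GRing.scale /= !mulr0.
Qed.

Lemma isaacs_character i : isaacs K F ->
  algebraic_integer (FPdim K F * l i / (formal_codegree l * fpdim K i)).
Proof.
move=> /(_ _ _ _ char_rep_irreducible char_idem_is_pci i).
by rewrite omega_char_idem.
Qed.

End Idempotent.

(** * Frobenius-Perron dimensions *)

(** The order is only partial. The maximum is always one of its arguments, which bounds it by d;
    nonnegative elements are comparable, which makes it at least d. *)
Lemma bigmax_nonneg_eq (K : numDomainType) (s : seq K) (d : K) :
  d \in s -> 0 <= d -> {in s, forall a, 0 <= a -> a <= d} ->
  \big[Num.max/0]_(a <- s | 0 <= a) a = d.
Proof.
move=> ds d0 sd; set M := \big[_/_]_(_ <- _ | _) _.
have [M0 Md dM] : [/\ 0 <= M, M <= d & d <= M]; last first.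
  by apply/eqP; rewrite eq_le Md dM.
rewrite {}/M; split.
- elim/big_ind: _ => // x y x0 y0; by rewrite /Order.max; case: ifP.
- rewrite big_seq_cond; elim/big_ind: _ => // [x y xd yd|a /andP[/sd]//].
  by rewrite /Order.max; case: ifP.
- have pos (r : seq K) : 0 <= \big[Num.max/0]_(a <- r | 0 <= a) a.
    elim/big_ind: _ => // x y x0 y0; by rewrite /Order.max; case: ifP.
  elim: s ds {sd} => // a s IHs; rewrite inE big_cons => /predU1P[<-|/IHs ds].
    by rewrite d0 comparable_le_max ?lexx // real_comparable ?ger0_real.
  case: ifP => // a0; rewrite comparable_le_max ?real_comparable ?ger0_real //.
  by rewrite ds orbT.
Qed.

Section FPdim.
Variables (K : numClosedFieldType) (F : fusion_ring).
Notation I := 'I_(frank F).+1.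
Variables (d : I -> K) (dP : fusion_character d) (d_gt0 : forall i, 0 < d i).

(* A positive character is a common Perron-Frobenius eigenvector: pairing it
   with |u|, for a row eigenvector u of eigenvalue a >= 0, gives a <= d i. *)
Lemma fpdim_character i : fpdim K i = d i.
Proof.
have specE a : (a \in spectrum (fus_mx K i)) = eigenvalue (fus_mx K i) a.
  rewrite eigenvalue_root_char /spectrum; case: closed_field_poly_normal => r.
  move=> /= {1}->; rewrite (monicP (char_poly_monic _)) scale1r.
  by rewrite root_prod_XsubC.
pose v : 'cV[K]_(frank F).+1 := \col_k d k.
have Mv : fus_mx K i *m v = d i *: v.
  apply/colP => j; rewrite !mxE dP.2; apply: eq_bigr => k _.
  by rewrite !mxE.
have v0 k : v k 0 = d k by rewrite mxE.
apply: bigmax_nonneg_eq => [||a]; [|exact: ltW|].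
  (* Otherwise [fus_mx K i - d i] would be invertible, yet it kills the positive vector v. *)
  rewrite specE /eigenvalue /eigenspace kermx_eq0 row_free_unit.
  apply/negP => Mu; have := d_gt0 ord0.
  rewrite -v0 -(mulKmx Mu v) mulmxBl Mv mul_scalar_mx subrr mulmx0 mxE.
  by rewrite ltxx.
rewrite specE => /eigenvalueP[u Mu u_neq0] a0.
pose S := \sum_k `|u 0 k| * d k.
have [k uk0] : exists k, u 0 k != 0.
  apply/existsP; apply: contraR u_neq0; rewrite negb_exists => /forallP u0.
  by apply/eqP/rowP => k; rewrite mxE; apply/eqP; rewrite -[_ == _]negbK u0.
have S_gt0 : 0 < S.
  rewrite /S (bigD1 k) //= ltr_pwDl ?mulr_gt0 ?normr_gt0 // sumr_ge0 // => j _.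
  by rewrite mulr_ge0 // ltW.
rewrite -(ler_pM2r S_gt0) !mulr_sumr.
(* The middle term is |u| M v: the triangle inequality bounds a |u| by |u| M entrywise, and M v =
   d_i v turns it into d_i S. *)
apply: (@le_trans _ _
  (\sum_k (\sum_j `|u 0 j| * (fusN i j k)%:R) * d k)).
  apply: ler_sum => m _; rewrite mulrA ler_pM2r //.
  rewrite -{1}(ger0_norm a0) -normrM.
  move/rowP/(_ m): Mu; rewrite !mxE => <-.
  apply: le_trans (ler_norm_sum _ _ _) _; apply: ler_sum => j _.
  by rewrite mxE normrM normr_nat.
under eq_bigr => m _ do rewrite mulr_suml.
rewrite exchange_big /= le_eqVlt; apply/orP; left; apply/eqP.
apply: eq_bigr => j _; rewrite mulrCA dP.2 mulr_sumr.
by apply: eq_bigr => m _; rewrite mulrA.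
Qed.

End FPdim.

(** * Integrality *)

(** If q = f g over the integers, the leading coefficients of f and g are prime to p, so degrees
    survive reduction; irreducibility mod p then forces a nonconstant f to have the degree of q. *)
Lemma irreducible_Fp_rat (p : nat) (q : {poly int}) :
  prime p -> ~~ (p %| lead_coef q)%Z ->
  irreducible_poly (map_poly intr q : {poly 'F_p}) ->
  irreducible_poly (map_poly intr q : {poly rat}).
Proof.
move=> p_prime pNq [qp_gt1 qp_irr]; apply/irreducible_rat_int.
have lcN0 (r : {poly int}) :
    ~~ (p %| lead_coef r)%Z -> (lead_coef r)%:~R != 0 :> 'F_p.
  by rewrite -(dvdz_pcharf (pchar_Fp p_prime)).
have sizep (r : {poly int}) : ~~ (p %| lead_coef r)%Z ->
    size (map_poly intr r : {poly 'F_p}) = size r.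
  by move=> /lcN0; apply: size_map_poly_id0.
split=> [|f' f'1]; first by rewrite -(sizep q).
have q0 : q != 0 by apply: contraNneq pNq => ->; rewrite lead_coef0 dvdz0.
(* Divisibility in [{poly int}] is pseudo-divisibility, that is, over the rationals; the primitive
   part of f' is a true divisor. *)
move=> f'q; have f'0 : f' != 0 by apply: contraTneq f'q => ->; rewrite dvd0p.
have [g q_eq] := dvdpP_int f'q; move: q_eq; set f := zprimitive f' => q_eq.
have f'E : f' %= f.
  by rewrite [f' in f' %= _]zpolyEprim eqp_scale // zcontents_eq0.
apply: (eqp_trans f'E); rewrite (eqp_size f'E) in f'1.
have /andP[pNf pNg] : ~~ (p %| lead_coef f)%Z && ~~ (p %| lead_coef g)%Z.
  rewrite -negb_or; apply: contra pNq; rewrite q_eq lead_coefM.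
  by case/orP=> ?; [apply: dvdz_mulr | apply: dvdz_mull].
have f_dvd : (map_poly intr f : {poly 'F_p}) %| map_poly intr q.
  by rewrite q_eq rmorphM dvdp_mulIl.
have f1p : size (map_poly intr f : {poly 'F_p}) != 1%N by rewrite sizep.
have /eqp_size := qp_irr _ f1p f_dvd.
rewrite !sizep // => fq; rewrite /eqp q_eq dvdp_mulIl /=.
have f0 : f != 0 by apply: contra_neq q0; rewrite q_eq => ->; rewrite mul0r.
have g0 : g != 0 by apply: contra_neq q0; rewrite q_eq => ->; rewrite mulr0.
have : size g = 1%N.
  move: fq; rewrite q_eq size_mul //.
  move: f0 g0; rewrite -!size_poly_gt0; case: (size f) (size g) => [|m] [|n] //.
  by move=> _ _; rewrite addnS /= -[LHS]addn0 => /addnI <-.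
move/eqP/size_poly1P=> [c c0 ->].
rewrite -dvdp_rat_int rmorphM /= map_polyC /= mulrC mul_polyC.
by rewrite dvdpZl // intr_eq0.
Qed.

(** By Gauss's lemma the primitive part of q divides the monic p over the integers, so its leading
    coefficient is a unit and that of q is the content of q up to sign. *)
Lemma lead_coef_dvd_integral (K : numClosedFieldType) (q : {poly int}) (z : K) :
  irreducible_poly (map_poly intr q : {poly rat}) ->
  root (map_poly intr q) z -> algebraic_integer z ->
  forall i, (lead_coef q %| q`_i)%Z.
Proof.
move=> q_irr qz [p p_monic pz] i.
have ratrE (r : {poly int}) :
    map_poly (intr : int -> K) r
    = map_poly ratr (map_poly (intr : int -> rat) r).
  by rewrite -map_poly_comp; apply: eq_map_poly => x /=; rewrite ratr_int.
have q_dvd_p : q %| p.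
  rewrite -dvdp_rat_int.
  set qQ := map_poly _ q; set pQ := map_poly _ p.
  (* The rational gcd of q and p vanishes at z, so it is not constant and is associate to q. *)
  have gz : root (map_poly ratr (gcdp qQ pQ)) z.
    by rewrite gcdp_map root_gcd -!ratrE qz pz.
  have g1 : size (gcdp qQ pQ) != 1%N.
    rewrite -(size_map_poly (@ratr K)); apply: contraTneq gz => /eqP.
    by case/size_poly1P => c c0 ->; rewrite rootC.
  by rewrite -(eqp_dvdl _ (q_irr _ g1 (dvdp_gcdl _ _))) dvdp_gcdr.
have [r pE] := dvdpP_int q_dvd_p.
have : lead_coef (zprimitive q) * lead_coef r = 1.
  by rewrite -lead_coefM -pE; apply/monicP.
move=> /(congr1 absz); rewrite abszM => /eqP; rewrite muln_eq1 => /andP[lq _].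
have -> : lead_coef q = zcontents q * lead_coef (zprimitive q).
  by rewrite {1}[q]zpolyEprim lead_coefZ.
have -> : q`_i = zcontents q * (zprimitive q)`_i.
  by rewrite {1}[q]zpolyEprim coefZ.
by rewrite dvdz_mul // dvdzE (eqP lq) dvd1n.
Qed.

Lemma horner_int_cubic (R : comNzRingType) (a b c d : int) (x : R) :
  (map_poly intr (Poly [:: d; c; b; a])).[x]
  = a%:~R * x ^+ 3 + b%:~R * x ^+ 2 + c%:~R * x + d%:~R.
Proof. by rewrite map_Poly horner_Poly /=; ring. Qed.

(** Mod 2 the cubic takes the value 1 at both 0 and 1; without roots, it is irreducible. *)
Lemma odd_cubic_not_integral (K : numClosedFieldType) (a b c d : int) (z : K) :
  ~~ (2 %| a)%Z -> ~~ (2 %| d)%Z -> ~~ (2 %| b + c)%Z -> ~~ (a %| b)%Z ->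
  a%:~R * z ^+ 3 + b%:~R * z ^+ 2 + c%:~R * z + d%:~R = 0 ->
  ~ algebraic_integer z.
Proof.
move=> a_odd d_odd bc_odd aNb z0 /lead_coef_dvd_integral z_int.
have F2 (x : 'F_2) : x = 0 \/ x = 1.
  by case: x => [[|[|//]] ltx]; [left | right]; apply: val_inj.
have odd1 (n : int) : ~~ (2 %| n)%Z -> n%:~R = 1 :> 'F_2.
  rewrite (dvdz_pcharf (pchar_Fp (isT : prime 2))).
  by case: (F2 n%:~R) => ->; rewrite ?eqxx.
have a0 : a != 0 by apply: contraNneq a_odd => ->; rewrite dvdz0.
pose q := Poly [:: d; c; b; a].
have sq : q = [:: d; c; b; a] :> seq int by rewrite (PolyK (c := 0)).
have lq : lead_coef q = a by rewrite lead_coefE sq.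
have := z_int q _ _ 2; rewrite lq sq (negPf aNb) => /(_ _ _)/negP[]//.
  apply: (@irreducible_Fp_rat 2) => //; first by rewrite lq.
  apply: cubic_irreducible => [|x].
    by rewrite size_map_poly_id0 ?lq ?odd1 ?oner_neq0 // sq.
  rewrite rootE horner_int_cubic (odd1 a) // (odd1 d) //.
  have [->|->] := F2 x; first by rewrite !expr0n !mulr0 !add0r oner_neq0.
  by rewrite !expr1n !mulr1 -[1 + _ + _]addrA -intrD odd1.
by rewrite rootE horner_int_cubic z0.
Qed.

(** * The cubic field of conductor 13 *)

(* The triple (a, b, c) stands for a + b t + c t^2, where t^3 = 1 - t - 4 t^2.
   This t, with 0 < t < 1, is chosen so that all d_i have nonnegative
   coefficients, which makes their positivity obvious. *)
Definition cubic : Type := (int * int * int)%type.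
HB.instance Definition _ := GRing.Zmodule.on cubic.

Definition cubic_eval (K : comNzRingType) (t : K) (x : cubic) : K :=
  x.1.1%:~R + x.1.2%:~R * t + x.2%:~R * t ^+ 2.

(** Here u and v are the coefficients of t^3 and t^4, reduced by t^4 = -4 + 5 t + 15 t^2. *)
Definition cubic_mul (x y : cubic) : cubic :=
  let: (a, b, c) := x in
  let: (a', b', c') := y in
  let u := b * c' + c * b' in
  let v := c * c' in
  (a * a' + u - v *+ 4, a * b' + b * a' - u + v *+ 5,
   a * c' + b * b' + c * a' - u *+ 4 + v *+ 15).

Definition cubic_int (n : int) : cubic := (n, 0, 0).

(* sigma(t), another root of the cubic *)
Definition cubic_conj_root : cubic := (- 2, 3, 1).

Definition cubic_conj (x : cubic) : cubic :=
  let: (a, b, c) := x in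
  cubic_int a + cubic_conj_root *~ b
  + cubic_mul cubic_conj_root cubic_conj_root *~ c.

Section CubicEval.
Variables (K : comNzRingType) (t : K).
Hypothesis t_root : t ^+ 3 = 1 - t - 4 * t ^+ 2.

Lemma cubic_eval_is_zmod_morphism : zmod_morphism (cubic_eval t).
Proof.
by move=> [[a b] c] [[a' b'] c']; rewrite /cubic_eval /= !rmorphB /=; ring.
Qed.
HB.instance Definition _ :=
  GRing.isZmodMorphism.Build cubic K (cubic_eval t) cubic_eval_is_zmod_morphism.

Lemma cubic_evalD x y : cubic_eval t (x + y) = cubic_eval t x + cubic_eval t y.
Proof. exact: raddfD. Qed.

Lemma cubic_evalMz x n : cubic_eval t (x *~ n) = cubic_eval t x * n%:~R.
Proof. by rewrite mulrzr; apply: raddfMz. Qed.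

Lemma cubic_eval_int n : cubic_eval t (cubic_int n) = n%:~R.
Proof. by rewrite /cubic_eval /= !mul0r !addr0. Qed.

Lemma cubic_evalM x y :
  cubic_eval t (cubic_mul x y) = cubic_eval t x * cubic_eval t y.
Proof.
case: x y => [[a b] c] [[a' b'] c']; rewrite /cubic_eval /=; ring: t_root.
Qed.

(** This replaces an automorphism of [K] by a change of root: the dimensions and their conjugates
    are one table of triples read at two roots. *)
Lemma cubic_eval_conj x :
  cubic_eval t (cubic_conj x) = cubic_eval (cubic_eval t cubic_conj_root) x.
Proof.
case: x => [[a b] c].
rewrite /cubic_conj !cubic_evalD !cubic_evalMz cubic_evalM cubic_eval_int.
by rewrite -expr2 ![_ * _%:~R]mulrC.
Qed.

Lemma cubic_conj_root_root (t' := cubic_eval t cubic_conj_root) :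
  t' ^+ 3 = 1 - t' - 4 * t' ^+ 2.
Proof. by rewrite /t' /cubic_eval /=; ring: t_root. Qed.

Definition cubic_sum (s : seq cubic) : cubic := foldr +%R 0 s.

Lemma cubic_eval_sum m (x : nat -> cubic) :
  cubic_eval t (cubic_sum [seq x k | k <- iota 0 m])
  = \sum_(k < m) cubic_eval t (x k).
Proof.
rewrite -(big_mkord xpredT (fun k => cubic_eval t (x k))) /index_iota subn0.
elim: (iota 0 m) => [|k s IHs] /=; first by rewrite big_nil (cubic_eval_int 0).
by rewrite big_cons cubic_evalD IHs.
Qed.

End CubicEval.

Lemma cubic_eval_gt0 (K : numDomainType) (t : K) (x : cubic) :
  0 < t -> 0 < x.1.1 -> 0 <= x.1.2 -> 0 <= x.2 -> 0 < cubic_eval t x.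
Proof.
move=> t0 x0 x1 x2; rewrite /cubic_eval -addrA ltr_pwDl ?ltr0z //.
by rewrite addr_ge0 // mulr_ge0 ?ler0z ?exprn_ge0 // ltW.
Qed.

(** * Dimension tables and the criterion *)

Section Table.
Variables (m : nat) (M : seq (seq (seq nat))) (s : seq nat).
Variable c : seq cubic.
Local Notation "c `_ i" := (nth (0 : cubic) c i).

Definition table_character_check :=
  (c`_0 == cubic_int 1) &&
  all (fun i => all (fun j => cubic_mul c`_i c`_j ==
    cubic_sum [seq c`_k *~ tabN M i j k | k <- iota 0 m.+1])
    (iota 0 m.+1)) (iota 0 m.+1).

Definition table_positive_check :=
  all (fun i => [&& 0 < (c`_i).1.1, 0 <= (c`_i).1.2 & 0 <= (c`_i).2])
    (iota 0 m.+1).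

(* The four rings have the same dimension, 65 / (2 - 5 t). *)
Definition table_dim_check :=
  all (fun i => c`_(nth 0%N s i) == c`_i) (iota 0 m.+1) &&
  (cubic_mul (2, - 5, 0)
     (cubic_sum [seq cubic_mul c`_k c`_k | k <- iota 0 m.+1])
   == cubic_int 65).

Hypothesis Ms_ok : fusion_check m M s.
Notation F := (fusion_of_table Ms_ok).

Section Root.
Variables (K : comNzRingType) (t : K).
Hypothesis t_root : t ^+ 3 = 1 - t - 4 * t ^+ 2.

Let ordI (i : 'I_m.+1) : (i : nat) \in iota 0 m.+1.
Proof. by rewrite mem_iota /= add0n ltn_ord. Qed.

Definition table_character (i : 'I_(frank F).+1) : K := cubic_eval t c`_i.

Lemma table_characterP :
  table_character_check -> fusion_character table_character.
Proof.
case/andP=> /eqP c0 cM; split=> [|i j].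
  by rewrite /table_character c0 cubic_eval_int.
rewrite /table_character -cubic_evalM //.
have /allP/(_ _ (ordI i))/allP/(_ _ (ordI j))/eqP -> := cM.
rewrite cubic_eval_sum; apply: eq_bigr => k _.
by rewrite cubic_evalMz mulrC.
Qed.

Lemma table_character_dual i :
  table_dim_check -> table_character (fdual i) = table_character i.
Proof.
case/andP=> /allP/(_ _ (ordI i))/eqP cs _.
have /and5P[_ _ /allP/(_ _ (ordI i))/andP[si _] _ _] := Ms_ok.
by rewrite /table_character /= inordK // cs.
Qed.

Lemma table_dim : table_dim_check ->
  (2 - 5 * t) * \sum_i table_character i ^+ 2 = 65.
Proof.
case/andP=> _ /eqP/(congr1 (cubic_eval t)).
rewrite cubic_evalM // cubic_eval_sum cubic_eval_int rmorph_nat => <-.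
congr (_ * _); first by rewrite /cubic_eval /=; ring.
by apply: eq_bigr => i _; rewrite cubic_evalM.
Qed.

End Root.
End Table.

(* w / 5 is the value of omega at x_i. *)
Lemma table_not_isaacs (K : numClosedFieldType) (t : K) m M s
    (Ms_ok : fusion_check m M s) (c : seq cubic) (i : 'I_m.+1)
    (w : cubic) (b e : int) (ci := nth 0 c i) :
  0 < t -> t ^+ 3 = 1 - t - 4 * t ^+ 2 ->
  [&& table_character_check m M c, table_positive_check m c
    & table_dim_check m s c] ->
  cubic_mul w (cubic_mul (2, - 5, 0) ci)
  = cubic_conj (cubic_mul (2, - 5, 0) ci) *~ 5 ->
  cubic_mul w (cubic_mul w w) + cubic_mul w w *~ b + w *~ (5 * e)
  = cubic_int 125 ->
  ~~ (2 %| b + e)%Z -> ~~ (5 %| b)%Z ->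
  ~ isaacs K (fusion_of_table Ms_ok).
Proof.
move=> t0 t_root /and3P[c_char c_pos c_dim] wE w_root be_odd bN5 isaF.
set F := fusion_of_table Ms_ok in isaF.
have dP := table_characterP Ms_ok t_root c_char.
have lP := table_characterP Ms_ok (cubic_conj_root_root t_root) c_char.
have FP65 := table_dim Ms_ok t_root c_dim.
have f65 := table_dim Ms_ok (cubic_conj_root_root t_root) c_dim.
set t' := cubic_eval t cubic_conj_root in lP f65.
set l := table_character c t' in lP f65.
set d := table_character c t in dP FP65.
have d0 k : 0 < d k.
  have /allP/(_ k) := c_pos; rewrite mem_iota /= add0n ltn_ord => /(_ isT).
  by case/and3P => *; apply: cubic_eval_gt0.
(* Dual basis elements have equal triples, so the codegree is a sum of squares, computed by
   [table_dim] at the conjugate root. *)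
have fE : \sum_k l k ^+ 2 = formal_codegree l.
  by apply: eq_bigr => k _; rewrite [l (fdual k)]table_character_dual.
have FPE : \sum_k d k ^+ 2 = FPdim K F.
  by apply: eq_bigr => k _; rewrite (fpdim_character dP).
rewrite {}fE in f65; rewrite {}FPE in FP65.
have n65 : 65 != 0 :> K by rewrite pnatr_eq0.
have f0 : formal_codegree l != 0.
  by apply: contra_eq_neq f65 => ->; rewrite mulr0 eq_sym.
have FP0 : FPdim K F != 0.
  by apply: contra_eq_neq FP65 => ->; rewrite mulr0 eq_sym.
have := isaacs_character lP f0 i isaF; rewrite (fpdim_character dP) //.
set z := _ / _.
have zd : z * (formal_codegree l * d i) = FPdim K F * l i.
  by rewrite divfK // mulf_neq0 // gt_eqF.
(* Since FPdim = 65 / (2 - 5 t) and f = 65 / (2 - 5 t'), z = (2 - 5 t') l_i / ((2 - 5 t) d_i), and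
   [wE] identifies 5 z with w. *)
have zE : cubic_eval t w = 5 * z.
  have delta0 : 2 - 5 * t != 0.
    by apply: contra_eq_neq FP65 => ->; rewrite mul0r eq_sym.
  have dfN0 : (2 - 5 * t) * d i * formal_codegree l != 0.
    by rewrite !mulf_neq0 // gt_eqF.
  have evalE (u : K) : cubic_eval u (2, - 5, 0) = 2 - 5 * u.
    by rewrite /cubic_eval /=; ring.
  have /(congr1 (cubic_eval t)) := wE.
  rewrite cubic_evalMz cubic_eval_conj // !cubic_evalM ?cubic_conj_root_root //.
  rewrite !evalE -/t' -[cubic_eval t ci]/(d i) -[cubic_eval t' ci]/(l i) => wd.
  apply: (mulIf dfN0); rewrite mulrA wd.
  rewrite [LHS](_ : _ = (2 - 5 * t') * formal_codegree l * (5 * l i)).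
    rewrite [RHS](_ : _ = 5 * (2 - 5 * t) * (z * (formal_codegree l * d i))).
      by rewrite f65 -FP65 zd; ring.
    by ring.
  by ring.
(* Substitute w = 5 z in [w_root] and divide by 25. *)
have z_root : 5%:~R * z ^+ 3 + b%:~R * z ^+ 2 + e%:~R * z + (- 5)%:~R = 0.
  have /(congr1 (cubic_eval t)) := w_root.
  rewrite !cubic_evalD !cubic_evalMz !cubic_evalM // cubic_eval_int zE => z0.
  have n25 : 25 != 0 :> K by rewrite pnatr_eq0.
  apply: (mulfI n25); rewrite mulr0 -[RHS](subrr (125%:~R)) -{1}z0.
  ring.
by apply: (odd_cubic_not_integral _ _ be_odd bN5 z_root).
Qed.

(** * The four rings *)

(** X^3 + 4 X^2 + X - 1 is -1 at 0 and 5 at 1. Its discriminant is 169 = 13^2, a square, so its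
    field is cyclic. *)
Lemma conductor13_root (R : realType) :
  exists2 t : R[i], 0 < t & t ^+ 3 = 1 - t - 4 * t ^+ 2.
Proof.
pose p : {poly R} := 'X^3 + 4%:P * 'X^2 + 'X - 1.
have pE x : p.[x] = x ^+ 3 + 4 * x ^+ 2 + x - 1 by rewrite !hornerE.
have [|x /andP[x_ge0 _] /rootP] := @poly_ivt R p 0 1 ler01.
  by rewrite !pE; apply/andP; split; lra.
rewrite pE => x0; exists x%:C%C.
  rewrite ltcR lt_neqAle x_ge0 andbT; apply/eqP => x00.
  by move: x0; rewrite -x00; lra.
have := congr1 (real_complex R) x0.
rewrite !rmorphD rmorphN rmorphXn rmorphM rmorphXn rmorph1 rmorph0 rmorph_nat.
move=> /= x0C.
by rewrite -[LHS]subr0 -x0C; ring.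
Qed.

Definition EH1_dims : seq cubic :=
  [:: (1, 0, 0); (3, 1, 0); (5, 5, 1); (5, 9, 2); (8, 13, 3); (9, 17, 4)].
Definition EH2_dims : seq cubic :=
  [:: (1, 0, 0); (3, 1, 0); (2, 4, 1); (2, 4, 1); (5, 5, 1); (7, 13, 3);
      (7, 13, 3); (8, 13, 3)].
Definition EH3_dims : seq cubic :=
  [:: (1, 0, 0); (1, 4, 1); (1, 4, 1); (4, 5, 1); (4, 5, 1); (5, 5, 1);
      (8, 13, 3); (9, 17, 4)].
Definition EH4_dims : seq cubic :=
  [:: (1, 0, 0); (3, 8, 2); (3, 8, 2); (5, 5, 1); (5, 9, 2); (6, 9, 2);
      (6, 9, 2); (8, 13, 3)].

Local Open Scope complex_scope.

Theorem proposition5p1 (R : realType) :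
  [/\ ~ isaacs R[i] EH1, ~ isaacs R[i] EH2,
      ~ isaacs R[i] EH3 & ~ isaacs R[i] EH4].
Proof.
have [t t0 t_root] := conductor13_root R.
split.
(* In each case the ordinal picks an x_i whose dimension has norm 5 up to sign, the triple is w = 5
   z, and the integers are b and e in 5 z^3 + b z^2 + e z - 5. The first two rings share d_1 = 3 +
   t, hence the same z. *)
- apply: (@table_not_isaacs _ t _ _ _ _ EH1_dims (@Ordinal 6 1 isT)
    (97, 169, 39) (- 161) (- 176) t0 t_root); by vm_compute.
- apply: (@table_not_isaacs _ t _ _ _ _ EH2_dims (@Ordinal 8 1 isT)
    (97, 169, 39) (- 161) (- 176) t0 t_root); by vm_compute.
- apply: (@table_not_isaacs _ t _ _ _ _ EH3_dims (@Ordinal 8 7 isT)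
    (- 13, - 15, - 3) 21 6 t0 t_root); by vm_compute.
- apply: (@table_not_isaacs _ t _ _ _ _ EH4_dims (@Ordinal 8 4 isT)
    (11, - 59, - 17) (- 31) (- 124) t0 t_root); by vm_compute.
Qed.
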